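(* Let $R$ be a tolerance on $U$. Then $\mathit{RS}$ is an algebraic completely distributive lattice if and only if $R$ is induced by an irredundant covering of $U$.
   Context: A tolerance on $U$ is a reflexive and symmetric binary relation $R$ on $U$; $R(x)=\{y\in U\mid x\,R\,y\}$. For $X\subseteq U$, $X^{\blacktriangledown}=\{x\in U\mid R(x)\subseteq X\}$ and $X^{\blacktriangle}=\{x\in U\mid R(x)\cap X\neq\emptyset\}$. $\mathit{RS}=\{(X^{\blacktriangledown},X^{\blacktriangle})\mid X\subseteq U\}$ is ordered coordinatewise by inclusion. A complete lattice $L$ is completely distributive if for any doubly indexed subset $\{x_{i,j}\}_{i\in I,\,j\in J}$ of $L$, $\bigwedge_{i\in I}\bigl(\bigvee_{j\in J}x_{i,j}\bigr)=\bigvee_{f\colon I\to J}\bigl(\bigwedge_{i\in I}x_{i,f(i)}\bigr)$. An element $x$ of a complete lattice $L$ is compact if for every $S\subseteq L$, $x\le\bigvee S$ implies $x\le\bigvee F$ for some finite $F\subseteq S$. A complete lattice is algebraic if every element is a join of compact elements. (Being an algebraic or completely distributive lattice includes being a complete lattice.) A covering of $U$ is a collection $\mathcal{H}$ of nonempty subsets of $U$ with $\bigcup\mathcal{H}=U$; it is irredundant if $\mathcal{H}\setminus\{X\}$ is not a covering of $U$ for any $X\in\mathcal{H}$. The tolerance induced by a covering $\mathcal{H}$ is $R_{\mathcal{H}}=\bigcup\{X\times X\mid X\in\mathcal{H}\}$. *)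

(* Defs.v *)
From HB Require Import structures.
From mathcomp Require Import all_boot all_order.
From mathcomp Require Import boolp classical_sets cardinality.

Set Implicit Arguments.
Unset Strict Implicit.
Unset Printing Implicit Defensive.

Local Open Scope classical_set_scope.
Local Open Scope order_scope.

Section CompleteLattices.
Context {d : Order.disp_t} {L : porderType d}.

Definition complete_lattice : Prop :=
  forall S : set L, supremums S !=set0 /\ infimums S !=set0.

(* The library's [supremum] and [infimum] send the empty set to an explicit
   default element, so they cannot express joins and meets of empty families. *)
Definition join (hL : complete_lattice) (S : set L) : L :=
  sval (cid (hL S).1).

Definition meet (hL : complete_lattice) (S : set L) : L :=
  sval (cid (hL S).2).

Definition compact_element (hL : complete_lattice) (x : L) : Prop :=
  forall S : set L, x <= join hL S ->
    exists F : set L, [/\ finite_set F, F `<=` S & x <= join hL F].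

Definition algebraic (hL : complete_lattice) : Prop :=
  forall x : L, exists2 K : set L, K `<=` compact_element hL & x = join hL K.

Definition completely_distributive (hL : complete_lattice) : Prop :=
  forall (I J : Type) (x : I -> J -> L),
    meet hL (range (fun i => join hL (range (x i)))) =
    join hL (range (fun f : I -> J => meet hL (range (fun i => x i (f i))))).

End CompleteLattices.

Arguments complete_lattice {d} L.

Definition algebraic_completely_distributive_lattice
    (d : Order.disp_t) (L : porderType d) : Prop :=
  exists hL : complete_lattice L, algebraic hL /\ completely_distributive hL.

Section RoughSets.
Context {U : Type}.
Implicit Types (R : set (U * U)) (X : set U).

Definition tolerance R : Prop :=
  (forall x, R (x, x)) /\ (forall x y, R (x, y) -> R (y, x)).

Definition neighborhood R (x : U) : set U := [set y | R (x, y)].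

Definition lower_approx R X : set U := [set x | neighborhood R x `<=` X].

Definition upper_approx R X : set U :=
  [set x | neighborhood R x `&` X !=set0].

(* The product type [*p] carries the componentwise order, and the library's
   order on [set U] is inclusion. *)
Definition rough_pairs R : set (set U *p set U) :=
  range (fun X => (lower_approx R X, upper_approx R X)).

End RoughSets.

Record RS (U : Type) (R : set (U * U)) : Type := RoughPair {
  rough_pair : set U *p set U;
  rough_pairP : rough_pair \in rough_pairs R }.

HB.instance Definition _ (U : Type) (R : set (U * U)) :=
  [isSub for @rough_pair U R].
HB.instance Definition _ (U : Type) (R : set (U * U)) :=
  [Choice of RS R by <:].
HB.instance Definition _ (U : Type) (R : set (U * U)) :=
  [SubChoice_isSubPOrder of RS R by <:
    with Order.prod_display set_display set_display].

Section Coverings.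
Context {U : Type}.
Implicit Types (H : set (set U)).

Definition covering H : Prop :=
  (forall X, H X -> X !=set0) /\ \bigcup_(X in H) X = [set: U].

Definition irredundant H : Prop := forall X, H X -> ~ covering (H `\ X).

Definition induced_tolerance H : set (U * U) := \bigcup_(X in H) (X `*` X).

End Coverings.

(* Main.v *)
(* If [H] is an irredundant covering inducing [R], each [X] in [H] contains a
   point [c] lying in no other member, so that [R(c) = X] is a clique: [R] is
   induced by an irredundant covering iff every related pair lies in a clique
   of the form [R(c)].

   Under this condition a rough pair is determined by which of the points [c]
   its two components contain, and the arising pairs of sets are described by
   conditions stable under arbitrary unions and intersections.  Hence [RS] is
   a complete ring of sets up to isomorphism.

   Conversely, in an algebraic completely distributive lattice every element
   is a join of completely join-prime elements.  Joins in [RS] are unions in the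
   upper component, so if [y] is in [R(x)] there is a prime [p] below the pair of
   [{x}] whose upper component contains [y].  Primeness of [p] forces its upper
   component to be a clique of the form [R(a)]. *)
Require Import Defs.
From HB Require Import structures.
From mathcomp Require Import all_boot all_order.
From mathcomp Require Import boolp classical_sets cardinality.

Import Order.TTheory.

Local Open Scope classical_set_scope.

(** * Join-primes in complete lattices, and complete rings of sets *)

Section CompleteLatticeTheory.
Context {d : Order.disp_t} {L : porderType d}.
Implicit Types (hL : complete_lattice L) (S : set L).
Local Open Scope order_scope.

Lemma join_ub hL S x : S x -> x <= join hL S.
Proof. by rewrite /join; case: cid => j /= [ub _]; apply: ub. Qed.

Lemma join_le hL S z : (forall x, S x -> x <= z) -> join hL S <= z.
Proof. by rewrite /join; case: cid => j /= [_ lub] h; apply: lub. Qed.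

Lemma meet_lb hL S x : S x -> meet hL S <= x.
Proof. by rewrite /meet; case: cid => j /= [lb _]; apply: lb. Qed.

Lemma le_meet hL S z : (forall x, S x -> z <= x) -> z <= meet hL S.
Proof. by rewrite /meet; case: cid => j /= [_ glb] h; apply: glb. Qed.

Lemma join_subset hL S S' : S `<=` S' -> join hL S <= join hL S'.
Proof. by move=> sub; apply: join_le => x /sub; apply: join_ub. Qed.

(* Only nonempty [S] are considered, so the bottom element counts as way below
   every element and as completely join-prime. *)
Definition completely_way_below hL (y x : L) : Prop :=
  forall S, S !=set0 -> x <= join hL S -> exists2 s, S s & y <= s.

Definition completely_join_prime hL (p : L) : Prop :=
  completely_way_below hL p p.

(** Complete distributivity is applied to all nonempty sets whose join lies above [x]: the meet of
    one choice from each of them is way below [x]. *)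
Lemma completely_distributive_way_below hL (x : L) :
  completely_distributive hL ->
  x <= join hL [set y | completely_way_below hL y x].
Proof.
move=> cd.
pose I := {S : set L | S !=set0 /\ x <= join hL S}.
pose pt (S : I) : L := sval (cid (svalP S).1).
have ptP (S : I) : sval S (pt S) by rewrite /pt; case: cid.
(* All rows must share one index type, here [L]; indices outside [S] fall back to a point of [S],
   which is why [S] is taken nonempty. *)
pose elt (S : I) (l : L) : L := if `[< sval S l >] then l else pt S.
have eltP (S : I) l : sval S (elt S l) by rewrite /elt; case: asboolP.
apply: (@le_trans _ _ (meet hL (range (fun S : I => join hL (range (elt S)))))).
  apply: le_meet => _ [S _ <-]; apply: le_trans (svalP S).2 _.
  apply: join_subset => l Sl; exists l => //.
  by rewrite /elt; case: asboolP.
rewrite cd; apply: join_subset => _ [f _ <-] S S0 xS.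
exists (elt (exist _ S (conj S0 xS)) (f (exist _ S (conj S0 xS)))).
  exact: (eltP (exist _ S (conj S0 xS))).
by apply: meet_lb; exists (exist _ S (conj S0 xS)).
Qed.

Lemma completely_way_below_le hL (y x : L) : completely_way_below hL y x -> y <= x.
Proof.
move=> /(_ [set x])[]; first by exists x.
  by apply: join_ub.
by move=> _ ->.
Qed.

(** Compactness puts [k] below the join of a finite list of elements way below it; the members of a
    shortest such list are completely join-prime. *)
Lemma compact_join_prime hL (k : L) :
  completely_distributive hL -> compact_element hL k ->
  k <= join hL [set p | completely_join_prime hL p /\ p <= k].
Proof.
move=> cd /(_ _ (completely_distributive_way_below hL k cd)) [_ [/finite_seqP[s0 ->] s0W ks0]].
pose P n := `[< exists s : seq L, [/\ size s = n,
  [set` s] `<=` [set y | completely_way_below hL y k] & k <= join hL [set` s] ] >].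
have exP : exists n, P n by exists (size s0); apply/asboolP; exists s0.
have [n /asboolP[s [sn sW ks]] nmin] := ex_minnP exP.
apply: (le_trans ks); apply: join_subset => y /= ys.
have yk : completely_way_below hL y k by apply: sW.
split; last exact: completely_way_below_le yk.
move=> S S0 yS.
(* Removing [y] from [s] shrinks it, so by minimality the rest no longer
   covers [k]; hence [y] lies below an element of [S], not of the rest. *)
pose s' := [seq z <- s | z != y].
have s'sub : [set` s'] `<=` [set` s] by move=> z /=; rewrite mem_filter => /andP[].
have ks' : ~ k <= join hL [set` s'].
  move=> ks'; have /nmin : P (size s').
    by apply/asboolP; exists s'; split=> //; exact: subset_trans sW.
  rewrite -sn leqNgt size_filter -[X in (_ < X)%N](count_predC (fun z => z != y)).
  rewrite -[X in (X < _)%N]addn0 ltn_add2l -has_count.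
  by move=> /negP; apply; apply/hasP; exists y => //=; rewrite eqxx.
have [||z [Sz|zs'] yz] := yk (S `|` [set` s']).
- by case: S0 => z Sz; exists z; left.
- apply: (le_trans ks); apply: join_le => z zs.
  have [->|zy] := eqVneq z y.
    by apply: le_trans yS _; apply: join_subset => t; left.
  by apply: join_ub; right; rewrite /= mem_filter zy.
- by exists z.
- case: ks'; apply: (le_trans ks); apply: join_le => t ts.
  have [->|ty] := eqVneq t y; last by apply: join_ub; rewrite /= mem_filter ty.
  by apply: le_trans yz _; apply: join_ub.
Qed.

Lemma algebraic_completely_distributive_join_prime hL (x : L) :
  algebraic hL -> completely_distributive hL ->
  x = join hL [set p | completely_join_prime hL p /\ p <= x].
Proof.
move=> alg cd; apply/eqP; rewrite eq_le; apply/andP; split; last first.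
  by apply: join_le => p [].
have [K Kc xK] := alg x.
rewrite {1}xK; apply: join_le => k Kk.
apply: le_trans (compact_join_prime _ _ cd (Kc _ Kk)) _.
apply: join_subset => p [pp pk]; split=> //.
by apply: le_trans pk _; rewrite xK; exact: join_ub.
Qed.

(** Through [phi] joins become unions and meets intersections. Distributivity then amounts to
    choice, and the least element whose image contains a given point is compact. *)
Lemma complete_ring_of_sets (E : Type) (phi : L -> set E) :
  (forall a b, a <= b <-> phi a `<=` phi b) ->
  (forall S, exists l, phi l = \bigcup_(a in S) phi a) ->
  (forall S, exists l, phi l = \bigcap_(a in S) phi a) ->
  algebraic_completely_distributive_lattice L.
Proof.
move=> phi_le phi_cup phi_cap.
have hL : complete_lattice L.
  move=> S; split.
    have [l lE] := phi_cup S; exists l; split=> [a Sa|b ub].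
      by apply/phi_le; rewrite lE; exact: bigcup_sup.
    by apply/phi_le; rewrite lE; apply: bigcup_sub => a /ub /phi_le.
  have [l lE] := phi_cap S; exists l; split=> [a Sa|b lb].
    by apply/phi_le; rewrite lE; exact: bigcap_inf.
  by apply/phi_le; rewrite lE; apply: sub_bigcap => a /lb /phi_le.
have phi_join S : phi (join hL S) = \bigcup_(a in S) phi a.
  apply/seteqP; split; last first.
    by apply: bigcup_sub => a Sa; apply/phi_le; exact: join_ub.
  have [l lE] := phi_cup S; rewrite -lE; apply/phi_le.
  by apply: join_le => a Sa; apply/phi_le; rewrite lE; exact: bigcup_sup.
have phi_meet S : phi (meet hL S) = \bigcap_(a in S) phi a.
  apply/seteqP; split.
    by apply: sub_bigcap => a Sa; apply/phi_le; exact: meet_lb.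
  have [l lE] := phi_cap S; rewrite -lE; apply/phi_le.
  by apply: le_meet => a Sa; apply/phi_le; rewrite lE; exact: bigcap_inf.
have phi_inj a b : phi a = phi b -> a = b.
  by move=> ab; apply: le_anti; apply/andP; split; apply/phi_le; rewrite ab.
exists hL; split.
- move=> x; exists [set k | compact_element hL k /\ k <= x]; first by move=> k [].
  apply: le_anti; apply/andP; split; last by apply: join_le => k [].
  apply/phi_le; rewrite phi_join => e xe.
  have phi_principal : phi (meet hL [set a | phi a e]) e.
    by rewrite phi_meet => a.
  exists (meet hL [set a | phi a e]) => //; split; last exact: meet_lb.
  move=> S /phi_le /(_ _ phi_principal); rewrite phi_join => -[a Sa ae].
  exists [set a]; split; [exact: finite_set1|by move=> _ ->|].
  by apply: (@le_trans _ _ a); [exact: meet_lb|exact: join_ub].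
- move=> I J x; apply: phi_inj; rewrite phi_meet phi_join.
  apply/seteqP; split=> e.
    move=> he; have {}he i : exists j, phi (x i j) e.
      have := he (join hL (range (x i))); rewrite phi_join => -[|_ [j _ <-] ?].
        by exists i.
      by exists j.
    have [f fe] := choice he.
    exists (meet hL (range (fun i => x i (f i)))); first by exists f.
    by rewrite phi_meet => _ [i _ <-].
  move=> [_ [f _ <-]]; rewrite phi_meet => he _ [i _ <-].
  rewrite phi_join; exists (x i (f i)); first by exists (f i).
  by apply: he; exists i.
Qed.

End CompleteLatticeTheory.

(** * Clique centers and the traces of rough pairs on them *)

Section CliqueNeighborhoods.
Context {U : Type}.
Context (R : set (U * U)) (hR : tolerance R).
Implicit Types (I K X : set U).

Let R_refl x : R (x, x). Proof. exact: hR.1. Qed.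
Let R_sym {x y} : R (x, y) -> R (y, x). Proof. exact: hR.2. Qed.

Definition clique_center (c : U) : Prop :=
  forall x y, R (c, x) -> R (c, y) -> R (x, y).

Lemma irredundant_covering_clique_center (H : set (set U)) (X : set U) :
  covering H -> irredundant H -> R = induced_tolerance H -> H X ->
  exists2 c, clique_center c & neighborhood R c = X.
Proof.
move=> [H0 HU] irr RH HX.
have [c Xc cX] : exists2 c, X c & forall Y, H Y -> Y c -> Y = X.
  apply: contrapT => noc; apply: (irr X HX); split=> [Y [/H0] //|].
  apply/seteqP; split=> // x _.
  have [Y HY Yx] : (\bigcup_(X in H) X) x by rewrite HU.
  have [YX|YX] := pselect (Y = X); last by exists Y.
  apply: contrapT => nox; apply: noc; exists x; first by rewrite -YX.
  move=> Z HZ Zx; apply: contrapT => ZX; apply: nox; by exists Z.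
have nX : neighborhood R c = X.
  apply/seteqP; split=> [x|x Xx]; rewrite /neighborhood /= RH.
    by move=> [Y HY [/= /(cX _ HY) -> ]].
  by exists X.
exists c => // x y cx cy; rewrite RH; exists X => //; split.
  by rewrite /= -nX.
by rewrite /= -nX.
Qed.

Lemma induced_by_irredundant_coveringP :
  (exists H : set (set U),
    [/\ covering H, irredundant H & R = induced_tolerance H]) <->
  (forall x y, R (x, y) -> exists c, [/\ clique_center c, R (c, x) & R (c, y)]).
Proof.
split=> [[H [Hcov Hirr RH]] x y|hc].
  rewrite {1}RH => -[X HX [/= Xx Xy]].
  have [c cc cX] := irredundant_covering_clique_center H X Hcov Hirr RH HX.
  by exists c; split=> //; [move: Xx|move: Xy]; rewrite -cX.
exists (neighborhood R @` clique_center); split.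
- split=> [_ [c _ <-]|]; first by exists c; exact: R_refl.
  apply/seteqP; split=> // x _.
  have [c [cc cx _]] := hc x x (R_refl x).
  by exists (neighborhood R c) => //; exists c.
(* Related clique centers have equal neighborhoods, so R(a) is the only member containing [a]. *)
- move=> _ [a ca <-] [_ /seteqP[_ /(_ a I)]] [_ [[b cb <-] ba] Rba]; apply: ba.
  apply/seteqP; split=> x Rx; rewrite /neighborhood /=.
    exact: (cb a x Rba Rx).
  exact: (ca b x (R_sym Rba) Rx).
- apply/seteqP; split=> [[x y] Rxy|[x y] [_ [c cc <-] [/= cx cy]]].
    have [c [cc cx cy]] := hc x y Rxy.
    by exists (neighborhood R c); [exists c|split].
  exact: cc.
Qed.

(* The pairs of sets that agree on the clique centers with some rough pair; see
   [rough_trace_approx] and [rough_trace_realized]. *)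
Definition rough_trace I K : Prop :=
  [/\ forall c e, clique_center c -> clique_center e -> R (c, e) -> I c -> I e,
      forall c e, clique_center c -> clique_center e -> R (c, e) -> K c -> K e,
      forall c e x, clique_center c -> clique_center e ->
        R (c, x) -> R (e, x) -> I c -> K e &
      forall c, clique_center c -> (forall x, R (c, x) -> x = c) -> K c -> I c].

Lemma rough_trace_approx X :
  rough_trace (lower_approx R X) (upper_approx R X).
Proof.
split.
- by move=> c e cc ce Rce cX x Rex; apply: cX; apply: (ce c x (R_sym Rce) Rex).
- move=> c e cc ce Rce [x [Rcx Xx]]; exists x; split=> //.
  exact: (cc e x Rce Rcx).
- by move=> c e x cc ce cx ex cX; exists x; split=> //; exact: cX.
- by move=> c cc c1 [x [Rcx Xx]] y /c1 ->; rewrite -(c1 x Rcx).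
Qed.

(** Each clause of [rough_trace] leads from one membership to one membership, so it survives
    arbitrary unions and, likewise, intersections. *)
Lemma rough_trace_bigcup (J : Type) (A : set J) (I K : J -> set U) :
  (forall j, A j -> rough_trace (I j) (K j)) ->
  rough_trace (\bigcup_(j in A) I j) (\bigcup_(j in A) K j).
Proof.
move=> h; split.
- by move=> c e cc ce Rce [j Aj Ic]; exists j => //; case: (h j Aj) => sat _ _ _; exact: (sat c e).
- by move=> c e cc ce Rce [j Aj Kc]; exists j => //; case: (h j Aj) => _ sat _ _; exact: (sat c e).
- by move=> c e x cc ce cx ex [j Aj Ic]; exists j => //; case: (h j Aj) => _ _ IK _; exact: (IK c e x).
- by move=> c cc c1 [j Aj Kc]; exists j => //; case: (h j Aj) => _ _ _; apply.
Qed.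

Lemma rough_trace_bigcap (J : Type) (A : set J) (I K : J -> set U) :
  (forall j, A j -> rough_trace (I j) (K j)) ->
  rough_trace (\bigcap_(j in A) I j) (\bigcap_(j in A) K j).
Proof.
move=> h; split.
- by move=> c e cc ce Rce Ic j Aj; case: (h j Aj) => sat _ _ _; exact: (sat c e cc ce Rce (Ic j Aj)).
- by move=> c e cc ce Rce Kc j Aj; case: (h j Aj) => _ sat _ _; exact: (sat c e cc ce Rce (Kc j Aj)).
- by move=> c e x cc ce cx ex Ic j Aj; case: (h j Aj) => _ _ IK _; exact: (IK c e x cc ce cx ex (Ic j Aj)).
- by move=> c cc c1 Kc j Aj; case: (h j Aj) => _ _ _; apply => //; exact: Kc.
Qed.

(** Relatedness is an equivalence between clique centers, so one center can be chosen from each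
    class. *)
Lemma clique_center_transversal : exists T : set U,
  [/\ T `<=` clique_center,
      forall s t, T s -> T t -> R (s, t) -> s = t &
      forall c, clique_center c -> exists2 t, T t & R (c, t)].
Proof.
(* The choice is made on sets, so that equal classes get the same point; the option provides a value
   at the empty set. *)
have [Y|f fP] := @choice _ _
    (fun (Y : set U) o => Y !=set0 -> exists2 t, o = Some t & Y t).
  have [[t Yt]|Y0] := pselect (Y !=set0); last by exists None.
  by exists (Some t) => _; exists t.
pose Q c : set U := [set e | clique_center e /\ R (c, e)].
have QE c e : clique_center c -> clique_center e -> R (c, e) -> Q c = Q e.
  move=> cc ce Rce; apply/seteqP; split=> x [cx Rx]; split=> //.
    exact: (cc e x Rce Rx).
  exact: (ce c x (R_sym Rce) Rx).
exists [set t | clique_center t /\ f (Q t) = Some t]; split.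
- by move=> t [].
- move=> s t [cs fs] [ct ft] Rst.
  by move: fs; rewrite (QE s t) // ft => -[].
- move=> c cc; have [|t ft [ct Rct]] := fP (Q c); first by exists c.
  by exists t => //; split=> //; rewrite -(QE c t).
Qed.

Lemma rough_trace_realized I K : rough_trace I K -> exists X,
  forall c, clique_center c ->
    (lower_approx R X c <-> I c) /\ (upper_approx R X c <-> K c).
Proof.
move=> [Isat Ksat IK KI1].
have [T [Tc Tinj Trep]] := clique_center_transversal.
pose V := \bigcup_(c in [set c | clique_center c /\ I c]) neighborhood R c.
(* The classes in [K] whose neighborhood misses [V] still have to be met, but
   must not be filled: they receive a single point each. *)
pose X := V `|` [set t | [/\ T t, K t & ~ (neighborhood R t `&` V !=set0)]].
have centerV c : clique_center c -> V c -> I c.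
  by move=> cc [e [ce Ie] Rec]; exact: Isat Ie.
exists X => c cc; split; split.
- move=> cX; have [/centerV|[Tc' Kc cV]] := cX c (R_refl c); first exact.
  (* Here R(c) misses [V], so it lies in [T], whose points are pairwise unrelated; thus R(c) = {c}
     and the last clause of [rough_trace] applies. *)
  apply: KI1 => // x Rcx; have [Vx|[Tx _ _]] := cX x Rcx.
    by case: cV; exists x.
  by rewrite (Tinj c x).
- by move=> Ic x Rcx; left; exists c.
- move=> [x [Rcx [[e [ce Ie] Rex]|[Tx Kx _]]]]; first exact: (IK e c x).
  by apply: (Ksat x c) => //; [exact: Tc|exact: R_sym].
- move=> Kc; have [[x [Rcx Vx]]|cV] := pselect (neighborhood R c `&` V !=set0).
    by exists x; split=> //; left.
  have [t Tt Rct] := Trep c cc.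
  exists t; split=> //; right; split=> //; first exact: (Ksat c t cc (Tc t Tt)).
  move=> [x [Rtx Vx]]; apply: cV; exists x; split=> //.
  exact: (Tc t Tt c x (R_sym Rct) Rtx).
Qed.

End CliqueNeighborhoods.

(** * The order on rough pairs and the two implications *)

Section RoughPairs.
Context {U : Type}.
Context (R : set (U * U)) (hR : tolerance R).

Let R_refl x : R (x, x). Proof. exact: hR.1. Qed.
Let R_sym {x y} : R (x, y) -> R (y, x). Proof. exact: hR.2. Qed.

Lemma RS_leE (a b : RS R) : (a <= b)%O <->
  (rough_pair a).1 `<=` (rough_pair b).1 /\
  (rough_pair a).2 `<=` (rough_pair b).2.
Proof.
rewrite -Order.le_val; split.
  by move=> /andP[]; rewrite !subsetEset.
by move=> ab; apply/andP; rewrite !subsetEset.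
Qed.

Definition rough_of (X : set U) : RS R :=
  RoughPair (mem_set (imageT (fun X => (lower_approx R X, upper_approx R X)) X)).

Lemma upper_approx1 (w x : U) : upper_approx R [set w] x -> R (x, w).
Proof. by move=> [z [Rxz zw]]; rewrite -[w]zw. Qed.

Lemma rough_ofP (p : RS R) : exists X, p = rough_of X.
Proof.
case: p => p pP; have [X _ pX] := set_mem pP; exists X.
by apply: val_inj; rewrite /= pX.
Qed.

(** The union [Y] of all sets whose rough pair is in [S] gives an upper bound of [S], and upper
    approximation preserves unions. *)
Lemma upper_join (hL : complete_lattice (RS R)) (S : set (RS R)) :
  (rough_pair (join hL S)).2 = \bigcup_(p in S) (rough_pair p).2.
Proof.
apply/seteqP; split; last first.
  by apply: bigcup_sub => p Sp; have /RS_leE[] := join_ub hL S p Sp.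
pose Y := \bigcup_(X in [set X | S (rough_of X)]) X.
have /RS_leE[_ /subset_trans] : (join hL S <= rough_of Y)%O.
  apply: join_le => p Sp; have [X pX] := rough_ofP p.
  have XY : X `<=` Y by apply: bigcup_sup; rewrite /= -pX.
  rewrite pX; apply/RS_leE; split=> [x /subset_trans|x [y [Rxy /XY Yy]]].
    exact.
  by exists y.
apply=> x [y [Rxy [X /= SX Xy]]]; exists (rough_of X) => //.
by exists y.
Qed.

Lemma clique_center_of_prime (hL : complete_lattice (RS R)) (p : RS R) (y : U) :
  completely_join_prime hL p -> (rough_pair p).1 = set0 -> (rough_pair p).2 y ->
  exists2 a, clique_center R a & (rough_pair p).2 = neighborhood R a.
Proof.
move=> pp p1 p2y.
pose V := [set w | ~ (p <= rough_of [set w])%O].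
(* Otherwise every point of the upper component is related to some [w] in [V]. As the lower
   component is empty, [p] is below the join of the pairs of these {w}, hence by primeness below one
   of them, against the definition of [V]. *)
have [e p2e eV] : exists2 e, (rough_pair p).2 e &
    forall w, R (e, w) -> (rough_pair p).2 `<=` neighborhood R w.
  apply: contrapT => none.
  have p2V e : (rough_pair p).2 e -> exists2 w, V w & R (e, w).
    move=> p2e; apply: contrapT => nw; apply: none; exists e => // w Rew x p2x.
    have /RS_leE[_ /(_ x p2x)] : (p <= rough_of [set w])%O.
      by apply: contrapT => Vw; apply: nw; exists w.
    by move=> /upper_approx1; exact: R_sym.
  have [||_ [w Vw <-]] := pp ((fun w => rough_of [set w]) @` V); last exact: Vw.
    by have [w Vw _] := p2V y p2y; exists (rough_of [set w]); exists w.
  apply/RS_leE; rewrite p1; split=> // x /p2V[w Vw Rxw].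
  rewrite upper_join; exists (rough_of [set w]); first by exists w.
  by exists w.
have [X pX] := rough_ofP p.
(* R(e,a) bounds the upper component by R(a); membership of [a] in [X] gives the reverse
   inclusion. *)
have [a [Rea Xa]] : upper_approx R X e by move: p2e; rewrite pX.
have p2a : (rough_pair p).2 = neighborhood R a.
  apply/seteqP; split; first exact: eV.
  by move=> x Rax; rewrite pX; exists a; split=> //; exact: R_sym.
exists a => // u v Rau Rav; apply: (eV u).
  by apply: (eV e) => //; rewrite p2a.
by rewrite p2a.
Qed.

Lemma algebraic_completely_distributive_clique (x y : U) :
  algebraic_completely_distributive_lattice (RS R) -> R (x, y) ->
  exists c, [/\ clique_center R c, R (c, x) & R (c, y)].
Proof.
move=> [hL [alg cd]] Rxy.
(* If R(x) = {x}, then [x] itself is the center. Otherwise the pair of {x} has empty lower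
   component, and so has every prime below it. *)
have [x1|x1] := pselect (forall z, R (x, z) -> z = x).
  exists x; split=> // u v /x1 -> /x1 ->; exact: R_refl.
have lx : lower_approx R [set x] = set0.
  apply/seteqP; split=> // z zx; apply: x1.
  have zxE : z = x by apply: zx; exact: R_refl.
  by move=> u; rewrite -{1}zxE => /zx.
have : (rough_pair (rough_of [set x])).2 y by exists x; split=> //; exact: R_sym.
rewrite (algebraic_completely_distributive_join_prime hL (rough_of [set x]) alg cd) upper_join.
move=> [p [pp /RS_leE[+ p2]] p2y]; rewrite /= lx subset0 => p1.
have [a ca paE] := clique_center_of_prime hL p y pp p1 p2y.
exists a; split=> //; last by move: p2y; rewrite paE.
by apply: upper_approx1; apply: p2; rewrite paE; exact: R_refl.
Qed.

Lemma clique_algebraic_completely_distributive :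
  (forall x y, R (x, y) ->
    exists c, [/\ clique_center R c, R (c, x) & R (c, y)]) ->
  algebraic_completely_distributive_lattice (RS R).
Proof.
move=> hc.
pose phi (p : RS R) : set (bool * {c | clique_center R c}) :=
  [set e | if e.1 then (rough_pair p).1 (sval e.2)
           else (rough_pair p).2 (sval e.2)].
have traceP (p : RS R) : rough_trace R (rough_pair p).1 (rough_pair p).2.
  by have [X ->] := rough_ofP p; exact: rough_trace_approx.
apply: (@complete_ring_of_sets _ _ _ phi).
- move=> a b; split=> [/RS_leE[ab1 ab2] [[] c]|ab].
  + exact: ab1.
  + exact: ab2.
  have ab1 c : clique_center R c -> (rough_pair a).1 c -> (rough_pair b).1 c.
    by move=> cc; apply: (ab (true, exist _ c cc)).
  have ab2 c : clique_center R c -> (rough_pair a).2 c -> (rough_pair b).2 c.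
    by move=> cc; apply: (ab (false, exist _ c cc)).
  have [X aX] := rough_ofP a; have [Y bY] := rough_ofP b.
  rewrite {}aX {}bY /= in ab1 ab2 *; apply/RS_leE; split=> x xX.
    (* Both inclusions pass through a center [c] whose clique contains [x] and [y]; being a clique,
       R(c) lies in R(x). *)
    move=> y /hc [c [cc cx cy]]; apply: (ab1 c cc) cy => z cz.
    by apply: xX; exact: (cc x z cx cz).
  have [y [/hc [c [cc cx cy]] Xy]] := xX.
  have [|z [cz Yz]] := ab2 c cc; first by exists y.
  by exists z; split=> //; exact: (cc x z cx cz).
- move=> S; have [X XE] := rough_trace_realized _ hR _ _
    (rough_trace_bigcup _ _ S _ _ (fun p _ => traceP p)).
  exists (rough_of X); apply/seteqP; split=> -[[] [c cc]]; have [X1 X2] := XE c cc.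
  + by move=> /X1 [p Sp ?]; exists p.
  + by move=> /X2 [p Sp ?]; exists p.
  + by move=> [p Sp ?]; apply/X1; exists p.
  + by move=> [p Sp ?]; apply/X2; exists p.
- move=> S; have [X XE] := rough_trace_realized _ hR _ _
    (rough_trace_bigcap _ _ S _ _ (fun p _ => traceP p)).
  exists (rough_of X); apply/seteqP; split=> -[[] [c cc]]; have [X1 X2] := XE c cc.
  + by move=> /X1 h p /h.
  + by move=> /X2 h p /h.
  + by move=> h; apply/X1 => p /h.
  + by move=> h; apply/X2 => p /h.
Qed.

End RoughPairs.

Theorem theorem4p8 (U : Type) (R : set (U * U)) (hR : tolerance R) :
  algebraic_completely_distributive_lattice (RS R) <->
  exists H : set (set U),
    [/\ covering H, irredundant H & R = induced_tolerance H].
Proof.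
rewrite induced_by_irredundant_coveringP //; split.
  by move=> acd x y; exact: algebraic_completely_distributive_clique.
exact: clique_algebraic_completely_distributive.
Qed.
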